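(* Let $f_1,\dots,f_n\in\mathcal{A}$. Suppose $D_1,\dots,D_n$ are continuous derivations of $\mathcal{A}$ such that $\det(D_jf_i)_{1\le i,j\le n}\neq 0$. Then the set of arithmetic functions $$\operatorname{Exp}^*\{f_i: 1\le i\le n\}$$ is algebraically independent over $\ker\{D_1,\dots,D_n\}$.
   Context: $\mathbb{N}=\{1,2,3,\dots\}$. An arithmetic function is a function $f:\mathbb{N}\to\mathbb{C}$. $\mathcal{A}$ is the commutative $\mathbb{C}$-algebra (an integral domain) of arithmetic functions under pointwise addition and convolution $(f*g)(n)=\sum_{d\mid n}f(d)g(n/d)$; $\alpha\in\mathbb{C}$ is identified with the function $1\mapsto\alpha$, $n\mapsto 0$ for $n>1$. All products, powers and determinants are taken in this ring. For $f\ne 0$ the order $v(f)$ is the least $n$ with $f(n)\neq 0$, and $v(0)=\infty$. $\|f\|=1/v(f)$ (with $1/\infty=0$) is a non-archimedean norm on $\mathcal{A}$, giving a metric $\|f-g\|$ and hence a topology on $\mathcal{A}$. A derivation of $\mathcal{A}$ is a $\mathbb{C}$-linear map $D:\mathcal{A}\to\mathcal{A}$ with $D(f*g)=Df*g+f*Dg$; it is continuous if it is continuous for this topology. For a set $\Delta$ of derivations, $\ker\Delta=\{x\in\mathcal{A}:Dx=0\ \forall D\in\Delta\}$. If $f(1)=0$, $\operatorname{Exp}(f)=\sum_{k\ge0}f^k/k!$ (convergent in the topology on $\mathcal{A}$ induced by the norm $\|\cdot\|$); in general $\operatorname{Exp}(f)=\exp(f(1))*\operatorname{Exp}(f-f(1))$.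 Let $\mathcal{A}_{\mathbb{R}}=\{f:f(1)\in\mathbb{R}\}$ and $\mathcal{A}_+=\{f:f(1)\in\mathbb{R},\,f(1)>0\}$. $\operatorname{Exp}$ restricts to a group isomorphism $(\mathcal{A}_{\mathbb{R}},+)\to(\mathcal{A}_+,* )$ with inverse $\operatorname{Log}:\mathcal{A}_+\to\mathcal{A}_{\mathbb{R}}$. $\operatorname{Exp}^m$ denotes $m$-fold composition for $m\ge 0$ ($\operatorname{Exp}^0=\mathrm{id}$), and $\operatorname{Exp}^{-k}=\operatorname{Log}^k$ ($k$-fold composition, where defined) for $k\ge1$. For each $f\in\mathcal{A}$ there is a largest $k\ge0$ such that $\operatorname{Log}^kf$ is defined. For nonempty $W\subseteq\mathcal{A}$, $k_W$ is the largest $k\ge0$ such that $\operatorname{Log}^{k}f$ is defined for every $f\in W$, and $\operatorname{Exp}^*W=\{\operatorname{Exp}^mf: f\in W,\ m\in\mathbb{Z},\ m\ge -k_W\}$. *)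

(* Defs.v *)
From HB Require Import structures.
From mathcomp Require Import all_boot all_order all_algebra.
From mathcomp Require Import all_classical all_reals all_analysis.
From mathcomp Require Import complex.
(* The notations of mpoly are incompatible with those of mathcomp-analysis. *)
From mathcomp Require Import -(notations) mpoly.

Set Implicit Arguments.
Unset Strict Implicit.
Unset Printing Implicit Defensive.

Import Order.TTheory GRing.Theory Num.Theory.
Import numFieldNormedType.Exports.

Local Open Scope classical_set_scope.
Local Open Scope ring_scope.

(* The domain of arithmetic functions is {1, 2, 3, ...}: the value at the junk
   index 0 is forced to be 0, so that Leibniz equality is the right one. *)
Record arith (R : realType) := Arith {
  arith_fun :> nat -> R[i];
  _ : arith_fun 0%N == 0 }.

HB.instance Definition _ (R : realType) := [isSub for @arith_fun R].
HB.instance Definition _ (R : realType) := [Choice of arith R by <:].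

Section ArithRing.
Variable R : realType.
Local Notation A := (arith R).
Implicit Types f g h : A.

Lemma arith_at0 f : f 0%N = 0.
Proof. by case: f => f /= /eqP. Qed.

Lemma arithP f g : f =1 g -> f = g.
Proof. by move=> fg; apply/val_inj/funext. Qed.

Fact arith_zero_subproof : (fun _ : nat => 0 : R[i]) 0%N == 0.
Proof. exact: eqxx. Qed.
Definition arith_zero : A := Arith arith_zero_subproof.

Fact arith_opp_subproof f : - f 0%N == 0.
Proof. by rewrite arith_at0 oppr0. Qed.
Definition arith_opp f : A := @Arith R (fun n => - f n) (arith_opp_subproof f).

Fact arith_add_subproof f g : f 0%N + g 0%N == 0.
Proof. by rewrite !arith_at0 addr0. Qed.
Definition arith_add f g : A :=
  @Arith R (fun n => f n + g n) (arith_add_subproof f g).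

Fact arith_addA : associative arith_add.
Proof. by move=> f g h; apply: arithP => n /=; rewrite addrA. Qed.
Fact arith_addC : commutative arith_add.
Proof. by move=> f g; apply: arithP => n /=; rewrite addrC. Qed.
Fact arith_add0 : left_id arith_zero arith_add.
Proof. by move=> f; apply: arithP => n /=; rewrite add0r. Qed.
Fact arith_addN : left_inverse arith_zero arith_opp arith_add.
Proof. by move=> f; apply: arithP => n /=; rewrite addNr. Qed.

HB.instance Definition _ := GRing.isZmodule.Build A
  arith_addA arith_addC arith_add0 arith_addN.

Fact arith_one_subproof : (fun n : nat => (n == 1%N)%:R : R[i]) 0%N == 0.
Proof. exact: eqxx. Qed.
Definition arith_one : A := Arith arith_one_subproof.

Definition conv f g (n : nat) : R[i] :=
  \sum_(d <- divisors n) f d * g (n %/ d)%N.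

Fact arith_mul_subproof f g : conv f g 0%N == 0.
Proof. by rewrite /conv big_seq1 arith_at0 mulr0. Qed.
Definition arith_mul f g : A := Arith (arith_mul_subproof f g).

Lemma convE f g (N n : nat) : (0 < n <= N)%N ->
  conv f g n = \sum_(i < N.+1) \sum_(j < N.+1 | (i * j == n)%N) f i * g j.
Proof.
case/andP=> n0 nN; rewrite /conv.
have -> : \sum_(d <- divisors n) f d * g (n %/ d)%N =
          \sum_(0 <= d < N.+1 | (d %| n)%N) f d * g (n %/ d)%N.
  rewrite -[RHS]big_filter; apply: perm_big; apply: uniq_perm.
  - exact: divisors_uniq.
  - by rewrite filter_uniq // iota_uniq.
  move=> d; rewrite mem_filter mem_index_iota -dvdn_divisors //=.
  case dn: (d %| n)%N => //=; rewrite ltnS.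
  by rewrite (leq_trans (dvdn_leq n0 dn)).
rewrite big_mkord big_mkcond /=; apply: eq_bigr => i _.
case: ifPn => [dn|ndn]; last first.
  rewrite big1 // => j /eqP ijn; case/negP: ndn.
  by rewrite -ijn dvdn_mulr.
have i0 : (0 < i)%N by rewrite (dvdn_gt0 n0).
have lt_nd : (n %/ i < N.+1)%N by rewrite ltnS (leq_trans (leq_div _ _)).
rewrite (big_pred1 (Ordinal lt_nd)) // => j /=.
by rewrite -val_eqE /= eqn_div // mulnC.
Qed.

Fact arith_mulC : commutative arith_mul.
Proof.
move=> f g; apply: arithP => n; case: (posnP n) => [->|n0].
  by rewrite !arith_at0.
rewrite /= !(@convE _ _ n) ?n0 ?leqnn // (exchange_big_dep xpredT) //=.
apply: eq_bigr => j _; rewrite big_mkcond [RHS]big_mkcond.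
by apply: eq_bigr => i _; rewrite mulnC mulrC.
Qed.

Let conv3 f g h n : (0 < n)%N ->
  arith_mul (arith_mul f g) h n =
  \sum_(i < n.+1) \sum_(j < n.+1) \sum_(k < n.+1 | (i * j * k == n)%N)
    f i * g j * h k.
Proof.
move=> n0 /=; rewrite (@convE _ _ n) ?n0 ?leqnn //=.
transitivity (\sum_(a < n.+1) \sum_(k < n.+1 | (a * k == n)%N)
  \sum_(i < n.+1) \sum_(j < n.+1 | (i * j == a)%N) f i * g j * h k).
  apply: eq_bigr => a _; apply: eq_bigr => k /eqP akn.
  have a0 : (0 < a <= n)%N.
    rewrite -[(a <= n)%N]ltnS ltn_ord andbT lt0n.
    by apply: contraTneq n0 => a0; rewrite -akn a0.
  rewrite (convE _ _ a0) mulr_suml; apply: eq_bigr => i _.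
  by rewrite mulr_suml.
transitivity (\sum_(a < n.+1) \sum_(i < n.+1) \sum_(j < n.+1) \sum_(k < n.+1)
  (if (i * j == a)%N && (a * k == n)%N then f i * g j * h k else 0)).
  apply: eq_bigr => a _; rewrite exchange_big /=; apply: eq_bigr => i _.
  rewrite [RHS]exchange_big /= [LHS]big_mkcond; apply: eq_bigr => k _.
  case: ifP => akn; last by rewrite big1 // => j _; rewrite andbF.
  by rewrite big_mkcond; apply: eq_bigr => j _; rewrite andbT.
rewrite exchange_big /=; apply: eq_bigr => i _.
rewrite exchange_big /=; apply: eq_bigr => j _.
rewrite exchange_big /= [RHS]big_mkcond; apply: eq_bigr => k _.
case: ifP => [/eqP ijkn|ijkn]; last first.
  by rewrite big1 // => a _; case: eqP => //= <-; rewrite ijkn.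
have lt_ij : (i * j < n.+1)%N.
  rewrite ltnS -[leqRHS]ijkn leq_pmulr // lt0n.
  by apply: contraTneq n0 => k0; rewrite -ijkn k0 muln0.
rewrite (bigD1 (Ordinal lt_ij)) //= eqxx ijkn eqxx big1 ?addr0 // => a.
by rewrite -val_eqE /= eq_sym => /negbTE ->.
Qed.

Fact arith_mulA : associative arith_mul.
Proof.
move=> f g h; apply: arithP => n; case: (posnP n) => [->|n0].
  by rewrite !arith_at0.
rewrite arith_mulC !conv3 //.
transitivity (\sum_(j < n.+1) \sum_(k < n.+1) \sum_(i < n.+1)
  (if (i * j * k == n)%N then f i * g j * h k else 0)).
  apply: eq_bigr => j _; apply: eq_bigr => k _; rewrite [LHS]big_mkcond.
  by apply: eq_bigr => i _; rewrite mulrC mulrA [in LHS]mulnC mulnA.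
under eq_bigr do rewrite exchange_big /=.
rewrite exchange_big /=; apply: eq_bigr => i _; apply: eq_bigr => j _.
by rewrite [RHS]big_mkcond.
Qed.

Fact arith_mul1 : left_id arith_one arith_mul.
Proof.
move=> f; apply: arithP => n; case: (posnP n) => [->|n0].
  by rewrite !arith_at0.
rewrite /= /conv (bigD1_seq 1%N) ?divisors_uniq -?dvdn_divisors //=.
rewrite mul1r divn1 big1 ?addr0 // => d /negbTE /= ->.
by rewrite mul0r.
Qed.

Fact arith_mulDl : left_distributive arith_mul arith_add.
Proof.
move=> f g h; apply: arithP => n /=; rewrite /conv -big_split /=.
by apply: eq_bigr => d _; rewrite mulrDl.
Qed.

Fact arith_1neq0 : arith_one != 0.
Proof.
by apply/eqP => /(congr1 (fun f : A => f 1%N)) /= /eqP; rewrite oner_eq0.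
Qed.

HB.instance Definition _ := GRing.Zmodule_isComNzRing.Build A
  arith_mulA arith_mulC arith_mul1 arith_mulDl arith_1neq0.

Fact arith_scale_subproof (a : R[i]) f : a * f 0%N == 0.
Proof. by rewrite arith_at0 mulr0. Qed.
Definition arith_scale (a : R[i]) f : A :=
  @Arith R (fun n => a * f n) (arith_scale_subproof a f).

Fact arith_scaleA a b f :
  arith_scale a (arith_scale b f) = arith_scale (a * b) f.
Proof. by apply: arithP => n /=; rewrite mulrA. Qed.
Fact arith_scale1 : left_id 1 arith_scale.
Proof. by move=> f; apply: arithP => n /=; rewrite mul1r. Qed.
Fact arith_scaleDr : right_distributive arith_scale +%R.
Proof. by move=> a f g; apply: arithP => n /=; rewrite mulrDr. Qed.
Fact arith_scaleDl f : {morph arith_scale^~ f : a b / a + b}.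
Proof. by move=> a b; apply: arithP => n /=; rewrite mulrDl. Qed.

HB.instance Definition _ := GRing.Zmodule_isLmodule.Build R[i] A
  arith_scaleA arith_scale1 arith_scaleDr arith_scaleDl.

Fact arith_scaleAl (a : R[i]) f g : a *: (f * g) = (a *: f) * g.
Proof.
apply: arithP => n /=; rewrite /conv mulr_sumr.
by apply: eq_bigr => d _; rewrite mulrA.
Qed.

HB.instance Definition _ := GRing.Lmodule_isLalgebra.Build R[i] A
  arith_scaleAl.
HB.instance Definition _ := GRing.Lalgebra_isComAlgebra.Build R[i] A.

End ArithRing.

Section ArithMetric.
Variable R : realType.
Local Notation A := (arith R).
Implicit Types f g h : A.

(* ||f|| = 1 / v(f), where v(f) is the least n with f n != 0; ||0|| = 0. *)
Definition arith_norm f : R :=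
  if pselect (exists n, f n != 0) is left nz then (ex_minn nz)%:R^-1 else 0.

Lemma arith_norm_ge0 f : 0 <= arith_norm f.
Proof. by rewrite /arith_norm; case: pselect => // nz; rewrite invr_ge0. Qed.

Lemma arith_norm0_eq0 f : arith_norm f = 0 -> f = 0.
Proof.
rewrite /arith_norm; case: pselect => [nz|z _].
  case: ex_minnP => m fm _ /eqP; rewrite invr_eq0 pnatr_eq0 => /eqP m0.
  by rewrite m0 arith_at0 eqxx in fm.
apply: arithP => n; apply/eqP; apply: contra_notT z => fn.
by exists n.
Qed.

Lemma arith_norm0 : arith_norm 0 = 0.
Proof.
by rewrite /arith_norm; case: pselect => // -[n]; rewrite eqxx.
Qed.

Lemma arith_normN f : arith_norm (- f) = arith_norm f.
Proof.
have E : (exists n, (- f) n != 0) = (exists n, f n != 0).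
  by apply/propext; split=> -[n fn]; exists n; move: fn; rewrite /= oppr_eq0.
rewrite /arith_norm; case: pselect => [nz|z]; case: pselect => [nz'|z'] //.
- congr (_%:R^-1); case: ex_minnP => m fm mm; case: ex_minnP => p fp pp.
  apply/eqP; rewrite eqn_leq mm ?pp //; first by rewrite -oppr_eq0.
  by rewrite /= oppr_eq0.
- by case: z'; rewrite -E.
- by case: z; rewrite E.
Qed.

Lemma arith_normD f g :
  arith_norm (f + g) <= Num.max (arith_norm f) (arith_norm g).
Proof.
rewrite {1}/arith_norm; case: pselect => [nz|_]; last first.
  by rewrite le_max arith_norm_ge0.
have le_norm h m : h m != 0 -> m%:R^-1 <= arith_norm h.
  move=> hm; rewrite /arith_norm; case: pselect => [nz'|z]; last first.
    by case: z; exists m.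
  case: ex_minnP => p hp pp; rewrite lef_pV2 ?posrE ?ltr0n ?ler_nat ?pp //.
    by rewrite lt0n; apply: contraNneq hm => ->; rewrite arith_at0.
  by rewrite lt0n; apply: contraNneq hp => ->; rewrite arith_at0.
case: ex_minnP => m fgm _; rewrite le_max.
case: (eqVneq (f m) 0) => fm; last by rewrite le_norm.
case: (eqVneq (g m) 0) => gm; last by rewrite (le_norm g) ?orbT.
by move: fgm; rewrite /= fm gm addr0 eqxx.
Qed.

Definition arith_dist f g : R := arith_norm (f - g).

Fact arith_distxx f : arith_dist f f = 0.
Proof. by rewrite /arith_dist subrr arith_norm0. Qed.
Fact arith_dist_positivity f g : arith_dist f g = 0 -> f = g.
Proof. by move/arith_norm0_eq0/eqP; rewrite subr_eq0 => /eqP. Qed.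
Fact arith_dist_sym f g : arith_dist f g = arith_dist g f.
Proof. by rewrite /arith_dist -arith_normN opprB. Qed.
Fact arith_dist_triangle g f h :
  arith_dist f h <= arith_dist f g + arith_dist g h.
Proof.
rewrite /arith_dist -[f - h](subrKA g) (le_trans (arith_normD _ _)) //.
by rewrite ge_max lerDl lerDr !arith_norm_ge0.
Qed.

HB.instance Definition _ := isMetric.Build R A
  arith_distxx arith_dist_positivity arith_dist_sym arith_dist_triangle.
HB.instance Definition _ := isPointed.Build A 0.

End ArithMetric.

Section ExpLog.
Variable R : realType.
Local Notation A := (arith R).

Definition expC (z : R[i]) : R[i] :=
  let: (x +i* y)%C := z in ((expR x * cos y) +i* (expR x * sin y))%C.

Definition Exp_series (f : A) : A :=
  lim (series (fun k => (k`!%:R : R[i])^-1 *: f ^+ k) @ \oo).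

(* The constant alpha is identified with [alpha%:A]. *)
Definition Exp (f : A) : A :=
  (expC (f 1%N))%:A * Exp_series (f - (f 1%N)%:A).

Definition A_real : set A := [set f | f 1%N \is Num.real].

(* [0 < z] in [R[i]] means that z is real and positive. *)
Definition A_pos : set A := [set f | 0 < f 1%N].

(* The inverse of Exp : A_real -> A_pos; only meaningful on A_pos. *)
Definition Log (f : A) : A := xget 0 [set g | A_real g /\ Exp g = f].

Definition Log_defined (k : nat) (f : A) : Prop :=
  forall j, (j < k)%N -> A_pos (iter j Log f).

(* k_W; the default 0 is irrelevant when W is nonempty, because
   log x <= x - 1 bounds the number of times Log can be iterated. *)
Definition Log_depth (W : set A) : nat :=
  xget 0%N [set k | (forall f, W f -> Log_defined k f) /\
                    forall j, (forall f, W f -> Log_defined j f) -> (j <= k)%N].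

Definition Exp_iter (m : int) (f : A) : A :=
  match m with
  | Posz k => iter k Exp f
  | Negz k => iter k.+1 Log f
  end.

Definition Exp_star (W : set A) : set A :=
  [set h | exists f (m : int),
     [/\ W f, - (Log_depth W)%:Z <= m & h = Exp_iter m f]].

Definition derivation (D : A -> A) : Prop :=
  linear D /\ forall f g, D (f * g) = D f * g + f * D g.

Definition ker_der (Delta : set (A -> A)) : set A :=
  [set x | forall D, Delta D -> D x = 0].

End ExpLog.

(* Algebraic independence of the set S (not of a family) over the subring K:
   the points x i substituted for the variables are pairwise distinct. *)
Definition alg_independent (B : comNzRingType) (K S : set B) : Prop :=
  forall (k : nat) (x : 'I_k -> B), injective x -> (forall i, S (x i)) ->
  forall p : mpoly k B, (forall m, K (mcoeff m p)) -> meval x p = 0 -> p = 0.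

(* Main.v *)
From HB Require Import structures.
Require Import Defs.
From mathcomp Require Import all_boot all_order all_algebra.
From mathcomp Require Import all_classical all_reals all_analysis.
From mathcomp Require Import complex.
From mathcomp Require Import -(notations) mpoly.
From mathcomp Require Import ring.
Set Implicit Arguments.
Unset Strict Implicit.
Unset Printing Implicit Defensive.
Import Order.TTheory GRing.Theory Num.Theory.
Local Open Scope classical_set_scope.
Local Open Scope ring_scope.

(** Let [k] be the depth to which all the [f_i] have iterated logarithms and
    put [g_i = Log^k f_i]. As [Exp] inverts [Log] on functions with positive
    value at 1 ([LogK]), [f_i = Exp^k g_i], and every element of
    [Exp^* {f_i}] is some [y_{i,m} = Exp^m g_i] with [m >= 0]. A continuous
    derivation satisfies [D (Exp g) = Exp g * D g] ([der_Exp]), so the Jacobian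
    matrix of the [f_i] is that of the [g_i] with its rows multiplied by
    products of exponentials, and [J = (D_j g_i)] has a nonzero determinant [d].

    The combinations [E_j = sum_l adj(J)_{lj} D_l] are again derivations of the
    integral domain of arithmetic functions. They vanish on the common kernel
    of the [D_l], and [E_j g_i = d] if [i = j] and [0] otherwise. Hence [E_j]
    kills the whole tower [y_{i,0}, y_{i,1}, ...] for [i <> j], whereas along
    the [j]-th tower [d^-1 E_j] acts as differentiation of [z], [exp z],
    [exp (exp z)], etc. It is therefore enough to show, for one derivation,
    that each term of such a tower is transcendental over the ring generated
    by the constants and the previous terms ([transcendental_tower]):
    applied to [E_j], whose constants contain the other towers, this makes the
    [y_{i,m}], taken tower after tower, a sequence whose every term is
    transcendental over a ring containing the base ring and the earlier terms
    ([exp_towers_alg_indep]).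

    For one tower, write ['] for [d^-1 D]. The first term has derivative 1, so
    that deriving a relation lowers its degree ([transcendental_ker]). For a
    later term [x] let [S] be the ring generated by the constants and the terms
    before [x]; then [x' = u x] with [u] in [S]. In an algebraic relation of
    minimal degree [N] for [x] over [S], the constant coefficient [a] is nonzero
    because [x] is. If [b] is the leading coefficient, eliminating the leading
    terms between the relation and its derivative leaves a relation of smaller
    degree; its vanishing yields [a' b - a b' = N u a b], that is, [a / b] is a
    constant multiple of [exp (N * integral of u)] ([transcendental_exp]). Such [a] and [b] do not exist, for reasons of degree
    in the term [y] of the tower just before [x]: if [y] is not the first term,
    [u = y'] is [y] times an element of the smaller ring while derivation does
    not raise the degree in [y] ([no_exp_integral_adjoin_exp]); otherwise [u] is
    1 while derivation lowers the degree ([no_exp_integral_adjoin_ker]). *)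

(** * Derivations of commutative rings *)

(** Additivity is stated for differences, which gives [0] and opposites in one
    stroke. *)
Definition is_derivation (A : nzRingType) (D : A -> A) : Prop :=
  {morph D : f g / f - g} /\ forall f g, D (f * g) = D f * g + f * D g.

Section Derivation.
Variables (A : nzRingType) (D : A -> A) (hD : is_derivation D).

Lemma derB f g : D (f - g) = D f - D g. Proof. exact: hD.1. Qed.

Lemma derM f g : D (f * g) = D f * g + f * D g. Proof. exact: hD.2. Qed.

Lemma der0 : D 0 = 0.
Proof. by rewrite -[X in D X](subrr 0) derB subrr. Qed.

Lemma derN f : D (- f) = - D f.
Proof. by rewrite -sub0r derB der0 sub0r. Qed.

Lemma derD f g : D (f + g) = D f + D g.
Proof. by rewrite -[in LHS](opprK g) derB derN opprK. Qed.

Lemma der1 : D 1 = 0.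
Proof. by apply: (addrI (D 1)); rewrite addr0 -{3}[1]mulr1 derM mulr1 mul1r. Qed.

Lemma der_sum I (r : seq I) (P : pred I) (F : I -> A) :
  D (\sum_(i <- r | P i) F i) = \sum_(i <- r | P i) D (F i).
Proof. exact: (big_morph D derD der0). Qed.

End Derivation.

Section DerivationCom.
Variables (A : comNzRingType) (D : A -> A) (hD : is_derivation D).

Lemma derX f k : D (f ^+ k) = f ^+ k.-1 * D f *+ k.
Proof.
case: k => [|k]; first by rewrite expr0 (der1 hD).
elim: k => [|k IHk]; first by rewrite !expr1 expr0 mul1r.
rewrite exprS (derM hD) IHk /= mulrS exprS; ring.
Qed.

Lemma der_horner (p : {poly A}) x :
  D p.[x] = \sum_(i < size p) D p`_i * x ^+ i + p^`().[x] * D x.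
Proof.
rewrite horner_coef (der_sum hD).
under eq_bigr => i _ do rewrite (derM hD) derX.
rewrite big_split /=; congr (_ + _).
case: (posnP (size p)) => [/eqP|p_gt0].
  by rewrite size_poly_eq0 => /eqP->; rewrite size_poly0 big_ord0 linear0 horner0 mul0r.
rewrite -(prednK p_gt0) big_ord_recl mulr0n mulr0 add0r /=.
rewrite (@horner_coef_wide _ (size p).-1); last exact: size_poly.
rewrite mulr_suml; apply: eq_bigr => i _.
by rewrite coef_deriv /bump /= add1n; ring.
Qed.

End DerivationCom.

Lemma is_derivation_sum (A : comNzRingType) n (D : 'I_n -> A -> A) (a : 'I_n -> A) :
  (forall l, is_derivation (D l)) -> is_derivation (fun f => \sum_l a l * D l f).
Proof.
move=> hD; split=> [f g|f g].
  by rewrite -sumrB; apply: eq_bigr => l _; rewrite (derB (hD l)) mulrBr.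
rewrite mulr_suml mulr_sumr -big_split /=; apply: eq_bigr => l _.
by rewrite (derM (hD l)); ring.
Qed.

Section DerivationKernel.
Variables (A : comNzRingType) (I : Type) (D : I -> A -> A).
Hypothesis hD : forall i, is_derivation (D i).

(** The proof that the [D i] are derivations is a parameter so that the
    subring structure can be inferred from the predicate alone. *)
Definition der_ker (_ : forall i, is_derivation (D i)) : {pred A} :=
  [pred f | `[< forall i, D i f = 0 >]].

Lemma der_kerP f : reflect (forall i, D i f = 0) (f \in der_ker hD).
Proof. exact: asboolP. Qed.

Lemma der_ker_closed : subring_closed (der_ker hD).
Proof.
split=> [|f g /der_kerP Df /der_kerP Dg|f g /der_kerP Df /der_kerP Dg];
  apply/der_kerP => i.
- by rewrite (der1 (hD i)).
- by rewrite (derB (hD i)) Df Dg subr0.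
- by rewrite (derM (hD i)) Df Dg mul0r mulr0 addr0.
Qed.

HB.instance Definition _ := GRing.isSubringClosed.Build A (der_ker hD)
  der_ker_closed.

End DerivationKernel.

(** * Adjunction of one element *)

Section Adjoin.
Variables (A : comNzRingType) (S : subringClosed A) (x : A).

Definition adjoin : {pred A} :=
  [pred y | `[< exists2 p, p \is a polyOver S & y = p.[x] >]].

Lemma adjoinP y : reflect (exists2 p, p \is a polyOver S & y = p.[x]) (y \in adjoin).
Proof. exact: asboolP. Qed.

Lemma adjoin_closed : subring_closed adjoin.
Proof.
split=> [|_ _ /adjoinP[p Sp ->] /adjoinP[q Sq ->]|
          _ _ /adjoinP[p Sp ->] /adjoinP[q Sq ->]]; apply/adjoinP.
- by exists 1; rewrite ?rpred1 ?hornerC.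
- by exists (p - q); rewrite ?rpredB // hornerD hornerN.
- by exists (p * q); rewrite ?rpredM // hornerM.
Qed.

HB.instance Definition _ := GRing.isSubringClosed.Build A adjoin adjoin_closed.

Lemma sub_adjoin : {subset S <= adjoin}.
Proof. by move=> c Sc; apply/adjoinP; exists c%:P; rewrite ?polyOverC ?hornerC. Qed.

Lemma mem_adjoin : x \in adjoin.
Proof. by apply/adjoinP; exists 'X; rewrite ?polyOverX ?hornerX. Qed.

End Adjoin.

Definition transcendental_over (A : nzRingType) (S : {pred A}) (x : A) : Prop :=
  forall p : {poly A}, p \is a polyOver S -> p.[x] = 0 -> p = 0.

(** * Towers of iterated exponentials for one derivation *)

Section ExpTower.
Variables (A : idomainType) (charA : forall N, (0 < N)%N -> N%:R != 0 :> A).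
Variables (D : A -> A) (hD : is_derivation D) (d : A) (d_neq0 : d != 0).

(** Stability under the derivation [D / d], in a form that needs no inverse
    of [d]. *)
Definition der_stable (S : {pred A}) : Prop :=
  forall a, a \in S -> exists2 a', a' \in S & D a = d * a'.

(** Over the fraction field the excluded identity says that [a / b] has
    logarithmic derivative [N * u] for [D / d], i.e., that it is a constant
    multiple of the exponential of [N] times a primitive of [u]. *)
Definition no_exp_integral (S : {pred A}) (u : A) : Prop :=
  forall a b N, a \in S -> b \in S -> a != 0 -> b != 0 -> (0 < N)%N ->
    D a * b - a * D b != d * (u * a * b *+ N).

Let natr_gt0_neq0 (a : A) N : a != 0 -> (0 < N)%N -> a *+ N != 0.
Proof. by move=> a0 N0; rewrite -mulr_natr mulf_neq0 ?charA. Qed.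

Lemma der_horner_ker (S : subringClosed A) x p :
    {in S, forall c, D c = 0} -> D x = d -> p \is a polyOver S ->
  D p.[x] = d * p^`().[x].
Proof.
move=> S0 Dx /polyOverP Sp; rewrite (der_horner hD) Dx big1 => [|i _].
  by rewrite add0r mulrC.
by rewrite S0 ?mul0r.
Qed.

Lemma der_stable_adjoin_ker (S : subringClosed A) x :
  {in S, forall c, D c = 0} -> D x = d -> der_stable (adjoin S x).
Proof.
move=> S0 Dx _ /adjoinP[p Sp ->]; exists p^`().[x]; last exact: der_horner_ker Sp.
by apply/adjoinP; exists p^`(); rewrite ?polyOver_deriv.
Qed.

(** Write ['] for [D / d]. As [x' = u x], deriving [sum_i p_i x^i] turns the
    coefficient [p_i] into [p_i' + i u p_i]: the degree in [x] does not
    increase. *)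
Lemma der_horner_exp (S : subringClosed A) x u p :
    der_stable S -> u \in S -> D x = d * u * x -> p \is a polyOver S ->
  exists q : {poly A}, [/\ q \is a polyOver S, (size q <= size p)%N,
    D p.[x] = d * q.[x] & forall i, d * q`_i = D p`_i + d * (u * p`_i *+ i)].
Proof.
move=> Sstab Su Dx Sp; have /polyOverP Spi := Sp.
have /choice[c cP] : forall i, exists c, c \in S /\ D p`_i = d * c.
  by move=> i; have [c] := Sstab _ (Spi i); exists c.
pose q := \poly_(i < size p) (c i + u * p`_i *+ i).
have dq i : d * q`_i = D p`_i + d * (u * p`_i *+ i).
  rewrite coef_poly; case: ltnP => [_|le_pi]; first by rewrite mulrDr (cP i).2.
  by rewrite (nth_default _ le_pi) (der0 hD) !(mulr0, mul0rn) addr0.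
exists q; split=> //.
- by apply: polyOver_poly => i _; rewrite rpredD ?rpredMn ?rpredM // (cP i).1.
- exact: size_poly.
rewrite (@horner_coef_wide _ (size p) q) ?size_poly // [in LHS]horner_coef (der_sum hD).
rewrite mulr_sumr; apply: eq_bigr => i _.
rewrite mulrA dq mulrDl (derM hD) (derX hD) Dx; congr (_ + _).
case: (i : nat) => [|k]; first by rewrite !mulr0n !mulr0 mul0r.
by rewrite /= [in RHS]exprS; ring.
Qed.


Lemma der_stable_adjoin_exp (S : subringClosed A) x u :
  der_stable S -> u \in S -> D x = d * u * x -> der_stable (adjoin S x).
Proof.
move=> Sstab Su Dx _ /adjoinP[p Sp ->].
have [q [Sq _ -> _]] := der_horner_exp Sstab Su Dx Sp.
by exists q.[x] => //; apply/adjoinP; exists q.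
Qed.

(** By induction on the degree of a relation [p]. If [p_0 = 0] it can be divided
    by [x]. Otherwise let [q] be the derived relation given by [der_horner_exp];
    with [N] the degree of [p], [p_N q - q_N p] is a relation of smaller degree,
    hence zero, and its constant coefficient contradicts the hypothesis on
    [u]. *)
Lemma transcendental_exp (S : subringClosed A) x u :
    der_stable S -> u \in S -> no_exp_integral S u -> x != 0 ->
  D x = d * u * x -> transcendental_over S x.
Proof.
move=> Sstab Su Su_no x0 Dx p.
have [n] := ubnP (size p); elim: n p => // n IHn p; rewrite ltnS => le_pn Sp px0.
have /polyOverP Spi := Sp.
apply/eqP/negPn/negP => p_neq0.
have size_p : (0 < size p)%N by rewrite size_poly_gt0.
have [p0|p0] := eqVneq p`_0 0.
  have pE : p = (\poly_(i < (size p).-1) p`_i.+1) * 'X.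
    apply/polyP=> -[|i]; rewrite coefMX /= ?p0 // coef_poly -ltnS prednK //.
    case: ltnP => // le_pi; by rewrite nth_default.
  case/negP: p_neq0; rewrite pE mulf_eq0 polyX_eq0 orbF; apply/eqP/IHn.
  - by rewrite (leq_ltn_trans (size_poly _ _)) // prednK.
  - by apply: polyOver_poly => i _; apply: Spi.
  - by apply: (mulIf x0); rewrite mul0r -hornerMX -pE.
have [q [Sq le_qp Dp dq]] := der_horner_exp Sstab Su Dx Sp.
have qx0 : q.[x] = 0.
  by apply/(mulfI d_neq0); rewrite -Dp px0 (der0 hD) mulr0.
pose N := (size p).-1.
have [N0|N_gt0] := posnP N.
  move: px0 p0; rewrite (@size1_polyC _ p) ?hornerC ?coefC /= => [->|].
    by rewrite eqxx.
  by rewrite -(prednK size_p) -/N N0.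
pose r := p`_N *: q - q`_N *: p.
have r0 : r = 0.
  apply: IHn.
  - apply: leq_trans le_pn; rewrite -[X in (_ < X)%N](prednK size_p) ltnS.
    apply/leq_sizeP => i; rewrite leq_eqVlt => /predU1P[<-|lt_Ni].
      by rewrite !coefE mulrC subrr.
    have le_pi : (size p <= i)%N by rewrite -(prednK size_p).
    rewrite !coefE (nth_default _ le_pi) (nth_default _ (leq_trans le_qp le_pi)).
    by rewrite !mulr0 subrr.
  - by rewrite rpredB ?polyOverZ //; apply: (polyOverP Sq).
  - by rewrite hornerD hornerN !hornerZ px0 qx0 !mulr0 subr0.
have /eqP := congr1 (fun s : {poly A} => d * s`_0) r0.
rewrite !coefE mulr0 mulrBr !mulrA ![d * p`_N]mulrC -!mulrA !dq.
rewrite mulr0n mulr0 addr0 subr_eq0 => /eqP r0E.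
have := Su_no _ _ _ (Spi 0%N) (Spi N) p0 _ N_gt0.
rewrite -/(lead_coef p) lead_coef_eq0 => /(_ p_neq0)/eqP; apply.
rewrite mulrA dq -[p`_N]/(lead_coef p) in r0E.
by rewrite [D _ * _]mulrC r0E; ring.
Qed.

(** Comparison of degrees in [x]: for [a = p(x)] and [b = q(x)] of degrees [m]
    and [n], [a' b - a b'] has degree at most [m + n], whereas
    [N (u x) a b] has degree [m + n + 1]. *)
Lemma no_exp_integral_adjoin_exp (S : subringClosed A) x u :
    der_stable S -> u \in S -> u != 0 -> transcendental_over S x ->
  D x = d * u * x -> no_exp_integral (adjoin S x) (u * x).
Proof.
move=> Sstab Su u0 x_tr Dx _ _ N /adjoinP[p Sp ->] /adjoinP[q Sq ->].
move=> px0 qx0 N_gt0; apply/eqP => E.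
have [p' [Sp' le_p' Dp _]] := der_horner_exp Sstab Su Dx Sp.
have [q' [Sq' le_q' Dq _]] := der_horner_exp Sstab Su Dx Sq.
have p0 : p != 0 by apply: contraNneq px0 => ->; rewrite horner0.
have q0 : q != 0 by apply: contraNneq qx0 => ->; rewrite horner0.
pose w := p * q * ((u *+ N)%:P * 'X).
have /eqP : p' * q - p * q' - w = 0.
  apply: x_tr.
    by rewrite !(rpredB, rpredM) ?polyOverC ?rpredMn ?polyOverX.
  apply: (mulfI d_neq0); rewrite mulr0.
  transitivity (d * p'.[x] * q.[x] - p.[x] * (d * q'.[x]) -
                d * (u * x * p.[x] * q.[x] *+ N)); 
    first by rewrite !(hornerD, hornerN, hornerM, hornerC, hornerX); ring.
  by rewrite -Dp -Dq E subrr.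
rewrite subr_eq0 => /eqP wE.
have uN0 : u *+ N != 0 by apply: natr_gt0_neq0.
have size_w : size w = (size p + size q)%N.
  rewrite !size_mul ?polyC_eq0 ?polyX_eq0 ?mulf_neq0 ?polyC_eq0 ?polyX_eq0 //.
  rewrite size_polyC uN0 size_polyX /= addnS addn1 /= -[RHS](@prednK _) //.
  by rewrite addn_gt0 size_poly_gt0 p0.
have : (size w <= (size p + size q).-1)%N.
  rewrite -wE (leq_trans (size_polyD _ _)) // size_polyN geq_max.
  by rewrite !(leq_trans (size_polyMleq _ _)) // -!subn1 leq_sub2r ?leq_add.
by rewrite size_w leqNgt ltn_predL addn_gt0 size_poly_gt0 p0.
Qed.

(** Here [p(x)' = (dp/dX)(x)], so that a nonconstant relation of minimal degree
    would produce one of smaller degree, in characteristic 0. *)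
Lemma transcendental_ker (S : subringClosed A) x :
    {in S, forall c, D c = 0} -> D x = d -> transcendental_over S x.
Proof.
move=> S0 Dx p; have [n] := ubnP (size p).
elim: n p => // n IHn p; rewrite ltnS => le_pn Sp px0.
apply/eqP/negPn/negP => p_neq0.
have p'0 : p^`() = 0.
  apply: IHn; rewrite ?polyOver_deriv ?(leq_trans (lt_size_deriv p_neq0)) //.
  by apply: (mulfI d_neq0); rewrite -(der_horner_ker S0 Dx Sp) px0 (der0 hD) mulr0.
have pE : p = (p`_0)%:P.
  apply/polyP=> -[|i]; rewrite coefC //=; apply/eqP/negPn/negP => pi0.
  have := natr_gt0_neq0 pi0 (ltn0Sn i).
  by rewrite -coef_deriv p'0 coef0 eqxx.
by case/eqP: p_neq0; rewrite pE -[p`_0](hornerC _ x) -pE px0.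
Qed.

(** As derivation lowers the degree in [x], [a' b - a b'] has smaller degree
    than [N a b]. *)
Lemma no_exp_integral_adjoin_ker (S : subringClosed A) x :
    {in S, forall c, D c = 0} -> D x = d -> no_exp_integral (adjoin S x) 1.
Proof.
move=> S0 Dx _ _ N /adjoinP[p Sp ->] /adjoinP[q Sq ->] px0 qx0 N_gt0.
apply/eqP; rewrite !(der_horner_ker S0 Dx) // mul1r => E.
have p0 : p != 0 by apply: contraNneq px0 => ->; rewrite horner0.
have q0 : q != 0 by apply: contraNneq qx0 => ->; rewrite horner0.
have /eqP : p^`() * q - p * q^`() - p * q *+ N = 0.
  apply: (transcendental_ker S0 Dx).
    by rewrite !(rpredB, rpredM, rpredMn) ?polyOver_deriv.
  apply: (mulfI d_neq0); rewrite mulr0.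
  transitivity (d * p^`().[x] * q.[x] - p.[x] * (d * q^`().[x]) -
                d * (p.[x] * q.[x] *+ N)).
    by rewrite !(hornerD, hornerN, hornerM, hornerMn); ring.
  by rewrite E subrr.
rewrite subr_eq0 => /eqP wE.
have size_w : size (p * q *+ N) = (size p + size q).-1.
  by rewrite -scaler_nat size_scale ?charA // size_mul.
have p_gt0 : (0 < size p)%N by rewrite size_poly_gt0.
have q_gt0 : (0 < size q)%N by rewrite size_poly_gt0.
suff : (size (p * q *+ N)%R < (size p + size q).-1)%N by rewrite size_w ltnn.
have ltM (r s : {poly A}) : (0 < size r + size s < size p + size q)%N ->
    (size (r * s)%R < (size p + size q).-1)%N.
  move=> /andP[rs_gt0 lt_rs]; rewrite (leq_ltn_trans (size_polyMleq _ _)) //.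
  by rewrite -ltnS !prednK // addn_gt0 p_gt0.
rewrite -wE (leq_ltn_trans (size_polyD _ _)) // size_polyN gtn_max !ltM //.
  by rewrite addn_gt0 p_gt0 ltn_add2l lt_size_deriv.
by rewrite addn_gt0 q_gt0 orbT ltn_add2r lt_size_deriv.
Qed.

Section Tower.
Variables (S : subringClosed A) (x : nat -> A).
Hypotheses (S0 : {in S, forall c, D c = 0}) (Dx0 : D (x 0%N) = d).
Hypotheses (x_neq0 : forall m, x m.+1 != 0).
Hypothesis Dx : forall m, D (x m.+1) = x m.+1 * D (x m).

Fixpoint tower (m : nat) : subringClosed A :=
  if m is m'.+1 then adjoin (tower m') (x m') : subringClosed A else S.

Lemma sub_tower m : {subset S <= tower m}.
Proof. by elim: m => //= m IHm c /IHm; apply: sub_adjoin. Qed.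

Lemma mem_tower m l : (l < m)%N -> x l \in tower m.
Proof.
elim: m => //= m IHm; rewrite ltnS leq_eqVlt => /predU1P[->|/IHm xl].
  exact: mem_adjoin.
exact: sub_adjoin.
Qed.

(** With [u_m = x_1 ... x_m] one has [D x_m = d u_m], so that [D / d] sends
    [x_{m+1}] to [u_m x_{m+1}]. The induction carries that [u_m] lies in the
    ring generated by [S] and [x_0, ..., x_m] and has no exponential integral
    there, which is what [transcendental_exp] asks for the next step. *)
Lemma transcendental_tower m : transcendental_over (tower m) (x m).
Proof.
pose u m := \prod_(1 <= l < m.+1) x l.
have u0 : u 0%N = 1 by rewrite /u big_nil.
have uS k : u k.+1 = u k * x k.+1 by rewrite /u big_nat_recr.
have u_neq0 k : u k != 0.
  by elim: k => [|k IHk]; rewrite ?u0 ?oner_eq0 // uS mulf_neq0.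
have Dxu k : D (x k) = d * u k.
  elim: k => [|k IHk]; first by rewrite u0 mulr1.
  by rewrite Dx IHk uS mulrC mulrA.
have DxS k : D (x k.+1) = d * u k * x k.+1 by rewrite Dxu uS mulrA.
suff : [/\ transcendental_over (tower m) (x m), der_stable (tower m.+1),
  u m \in tower m.+1 & no_exp_integral (tower m.+1) (u m)] by case.
elim: m => [|m [_ IHst IHu IHno]].
  split.
  - exact: transcendental_ker S0 Dx0.
  - exact: der_stable_adjoin_ker S0 Dx0.
  - by rewrite u0 rpred1.
  - by rewrite u0; apply: no_exp_integral_adjoin_ker S0 Dx0.
have x_tr := transcendental_exp IHst IHu IHno (x_neq0 m) (DxS m).
split=> //.
- exact: der_stable_adjoin_exp IHst IHu (DxS m).
- by rewrite uS rpredM ?mem_adjoin // sub_adjoin.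
- by rewrite uS; apply: no_exp_integral_adjoin_exp IHst IHu (u_neq0 m) x_tr (DxS m).
Qed.

End Tower.

End ExpTower.


(** * Algebraic independence from successive transcendence *)

Section Independence.
Variable A : comNzRingType.

Lemma meval_muni N (p : mpoly N.+1 A) (t : nat -> A) :
  meval (fun i => t i) p = (map_poly (meval (fun i : 'I_N => t i)) (muni p)).[t N].
Proof.
rewrite muniE mevalE rmorph_sum /= horner_sum; apply: eq_bigr => m _.
rewrite map_polyZ map_polyXn hornerZ hornerXn /= mevalZ mevalX big_ord_recr /=.
rewrite !mulrA; congr (_ * _ * _); apply: eq_bigr => i _.
by rewrite mnmE.
Qed.

Definition mnm_rcons N (m : multinom N) (i : nat) : multinom N.+1 :=
  Multinom [tuple of rcons m i].

Lemma mnm_rcons_max N (m : multinom N) i : mnm_rcons m i ord_max = i.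
Proof. by rewrite multinomE (tnth_nth 0%N) nth_rcons size_tuple ltnn eqxx. Qed.

Lemma mnm_rcons_widen N (m : multinom N) i j :
  mnm_rcons m i (widen_ord (leqnSn N) j) = m j.
Proof.
rewrite multinomE (tnth_nth 0%N) nth_rcons size_tuple /= ltn_ord.
by rewrite [RHS]multinomE (tnth_nth 0%N).
Qed.

Lemma mnm_rconsK N (m : multinom N.+1) :
  mnm_rcons (Multinom [tuple m (widen_ord (leqnSn N) i) | i < N]) (m ord_max) = m.
Proof.
apply/mnmP => j; have [lt_jN|le_Nj] := ltnP j N.
  have -> : j = widen_ord (leqnSn N) (Ordinal lt_jN) by apply: val_inj.
  by rewrite mnm_rcons_widen mnmE.
have -> : j = ord_max.
  by apply/val_inj/eqP; rewrite eqn_leq le_Nj -ltnS ltn_ord.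
by rewrite mnm_rcons_max.
Qed.

Lemma mcoeff_muni N (p : mpoly N.+1 A) (m : multinom N) i :
  mcoeff m (muni p)`_i = mcoeff (mnm_rcons m i) p.
Proof.
rewrite muniE coef_sum raddf_sum /= [in RHS](mpolyE p) raddf_sum /=.
apply: eq_bigr => m' _.
rewrite coefZ coefXn mulr_natr raddfMn /= !mcoeffZ !mcoeffX -mulrnAr -mulrnA mulnb.
congr (_ * _%:R); congr (nat_of_bool _); apply/andP/eqP => [[/eqP<- /eqP->]|->].
  by rewrite mnm_rconsK.
by rewrite mnm_rcons_max; split=> //; apply/eqP/mnmP => j; rewrite mnmE mnm_rcons_widen.
Qed.

(** Induction on the number of variables: seen as a polynomial in its last
    variable, a relation has coefficients in [T] once the other variables are
    evaluated, so these all vanish and are relations in fewer variables. *)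
Lemma alg_indep_tower (C : {pred A}) N (t : nat -> A) :
    (forall c, (c < N)%N -> exists T : subringClosed A,
      [/\ {subset C <= T}, forall l, (l < c)%N -> t l \in T &
          transcendental_over T (t c)]) ->
  forall p : mpoly N A, (forall m, mcoeff m p \in C) ->
    meval (fun i => t i) p = 0 -> p = 0.
Proof.
elim: N => [|N IHN] tT p Cp p0.
  by rewrite (nvar0_mpolyC p) mevalC in p0 *; rewrite p0 mpolyC0.
have IHp := IHN (fun c lt_cN => tT c (ltnW lt_cN)).
have [T [CT tlT tr]] := tT N (ltnSn N).
rewrite meval_muni in p0.
have P0 : map_poly (meval (fun i : 'I_N => t i)) (muni p) = 0.
  apply: tr => //; apply/polyOverP => i; rewrite coef_map /= mevalE.
  apply: rpred_sum => m _; rewrite rpredM ?rpred_prod //.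
    by apply: CT; rewrite mcoeff_muni.
  by move=> j _; rewrite rpredX // tlT.
have up0 i : (muni p)`_i = 0.
  apply: IHp; first by move=> m; rewrite mcoeff_muni.
  by rewrite -coef_map P0 coef0.
apply/mpolyP => m; rewrite mcoeff0.
by rewrite -[m]mnm_rconsK -mcoeff_muni up0 mcoeff0.
Qed.

(** The relation among the [t (s i)] is turned into one among all the [t j] by
    sending the monomial with exponents [m] to the one with exponents [e m];
    since [s] is injective so is [e], and no two monomials merge. *)
Lemma alg_indep_reindex (C : subringClosed A) k N (t : 'I_N -> A)
    (s : 'I_k -> 'I_N) : injective s ->
    (forall p : mpoly N A, (forall m, mcoeff m p \in C) ->
       meval t p = 0 -> p = 0) ->
  forall p : mpoly k A, (forall m, mcoeff m p \in C) ->
    meval (fun i => t (s i)) p = 0 -> p = 0.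
Proof.
move=> s_inj tC p Cp p0.
pose e (m : multinom k) : multinom N :=
  Multinom [tuple (\sum_(i | s i == j) m i)%N | j < N].
have eE m i : e m (s i) = m i.
  by rewrite mnmE (big_pred1 i) // => j; rewrite (inj_eq s_inj).
have e_inj : injective e.
  by move=> m m' em; apply/mnmP => i; rewrite -!eE em.
pose q : mpoly N A := \sum_(m <- msupp p) mcoeff m p *: mpolyX A (e m).
have q0 : q = 0.
  apply: tC => [m|].
    rewrite /q raddf_sum /=; apply: rpred_sum => m' _.
    by rewrite mcoeffZ mcoeffX rpredM ?rpred_nat.
  rewrite -p0 [RHS]mevalE raddf_sum /=; apply: eq_bigr => m _.
  rewrite mevalZ mevalX; congr (_ * _).
  rewrite [RHS](partition_big s xpredT) //=; apply: eq_bigr => j _.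
  by rewrite mnmE expr_sum; apply: eq_bigr => i /eqP->.
apply/mpolyP => m; rewrite mcoeff0 [in LHS](mpolyE p).
have /(congr1 (mcoeff (e m))) := q0; rewrite mcoeff0 => <-.
rewrite /q !raddf_sum /=; apply: eq_bigr => m' _.
by rewrite !mcoeffZ !mcoeffX (inj_eq e_inj).
Qed.
End Independence.

(** The pair [(j, m)] is coded by [j * M + m], where [M] exceeds all the heights
    in use. For the term [c] of code [(j, m)] the ring required by
    [alg_indep_tower] is generated by [ker D_j] and the earlier terms of the
    [j]-th tower; it contains the earlier towers since [D_j] kills them. *)
Lemma exp_towers_alg_indep (A : idomainType) (n : nat) (D : 'I_n -> A -> A)
    (x : 'I_n -> nat -> A) (d : A) (C : subringClosed A) :
    (forall N, (0 < N)%N -> N%:R != 0 :> A) ->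
    (forall j, is_derivation (D j)) -> d != 0 ->
    (forall i j, D j (x i 0%N) = d *+ (i == j)) ->
    (forall i m, x i m.+1 != 0) ->
    (forall i j m, D j (x i m.+1) = x i m.+1 * D j (x i m)) ->
    (forall j, {in C, forall c, D j c = 0}) ->
  forall k (s : 'I_k -> 'I_n * nat), injective s ->
  forall p : mpoly k A, (forall m, mcoeff m p \in C) ->
    meval (fun i => x (s i).1 (s i).2) p = 0 -> p = 0.
Proof.
move=> charA hD d0 Dx0 x_neq0 DxS DC k s s_inj p Cp p0.
have Dx_ne i j m : i != j -> D j (x i m) = 0.
  move=> ij; elim: m => [|m IHm]; first by rewrite Dx0 (negPf ij).
  by rewrite DxS IHm mulr0.
pose M := (\max_i (s i).2).+1.
have ltM i : ((s i).2 < M)%N by rewrite ltnS (leq_bigmax i).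
pose t (c : nat) : A := if insub (c %/ M)%N is Some j then x j (c %% M)%N else 0.
have tE (j : 'I_n) m : (m < M)%N -> t (j * M + m)%N = x j m.
  move=> lt_mM; rewrite /t divnMDl // modnMDl divn_small // addn0 modn_small //.
  by rewrite valK.
have lt_code i : ((s i).1 * M + (s i).2 < n * M)%N.
  by rewrite (leq_trans (_ : _ < (s i).1.+1 * M)%N) ?leq_mul2r ?ltn_ord ?orbT //
    mulSn addnC ltn_add2r.
have code_inj : injective (fun i => Ordinal (lt_code i)).
  move=> i i' /(congr1 val) /= e; apply: s_inj.
  have := congr1 (modn^~ M) e; rewrite !modnMDl !modn_small // => e2.
  have := congr1 (divn^~ M) e; rewrite !divnMDl // !divn_small // !addn0.
  by move=> /val_inj e1; rewrite [s i]surjective_pairing e1 e2 -surjective_pairing.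
apply: (alg_indep_reindex code_inj (t := t \o val) _ Cp); last first.
  by rewrite -p0; apply: meval_eq => i /=; rewrite tE.
apply: alg_indep_tower => c lt_cN.
have lt_jn : (c %/ M < n)%N by rewrite ltn_divLR.
pose j := Ordinal lt_jn; pose kerD := der_ker (fun _ : unit => hD j).
exists (tower kerD (x j) (c %% M)%N); have kerT := @sub_tower A kerD (x j).
split=> [a Ca|l lt_lc|].
- by apply: kerT; apply/der_kerP => _; apply: DC.
- have lt_ln : (l %/ M < n)%N by rewrite (leq_ltn_trans (leq_div2r _ (ltnW lt_lc))).
  have -> : t l = x (Ordinal lt_ln) (l %% M)%N.
    by rewrite -tE ?ltn_mod //= -divn_eq.
  have [e|ne] := eqVneq (l %/ M)%N (c %/ M)%N.
    have -> : Ordinal lt_ln = j by apply: val_inj.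
    apply: mem_tower; move: lt_lc.
    by rewrite (divn_eq l M) (divn_eq c M) e ltn_add2l !modnMDl !modn_mod.
  by apply: kerT; apply/der_kerP => _; apply: Dx_ne.
- have -> : t c = x j (c %% M)%N by rewrite -tE ?ltn_mod //= -divn_eq.
  apply: (transcendental_tower charA (hD j) d0) => //.
  + by move=> a /der_kerP/(_ tt).
  + by rewrite Dx0 eqxx.
Qed.

#[local] Arguments Exp {R} f.
#[local] Arguments Log {R} f.

(** * The integral domain of arithmetic functions *)
Section ArithCoefficients.
Variable R : realType.
Local Notation A := (arith R).
Implicit Types f g h : A.

Lemma arith_mulE f g n : (f * g) n = \sum_(d <- divisors n) f d * g (n %/ d)%N.
Proof. by []. Qed.

Lemma arith_sumE I (r : seq I) (P : pred I) (F : I -> A) n :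
  (\sum_(i <- r | P i) F i) n = \sum_(i <- r | P i) F i n.
Proof. by apply: (big_morph (fun f : A => f n)). Qed.

Lemma arith_mulrnE f k n : (f *+ k) n = f n *+ k.
Proof. by elim: k => // k IHk; rewrite !mulrS -IHk. Qed.

Lemma arith_mul_at1 f g : (f * g) 1%N = f 1%N * g 1%N.
Proof. by rewrite arith_mulE big_seq1. Qed.

Lemma arith_scalerE (a : R[i]) f n : (a *: f) n = a * f n.
Proof. by []. Qed.

Lemma arith_oneE n : (1 : A) n = (n == 1%N)%:R.
Proof. by []. Qed.

Lemma arith_natr_neq0 k : (0 < k)%N -> k%:R != 0 :> A.
Proof.
move=> k0; apply/eqP => /(congr1 (fun f : A => f 1%N)).
by rewrite arith_mulrnE /= => /eqP; rewrite pnatr_eq0 eqn0Ngt k0.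
Qed.

(** Each factor has order at least 2 and orders multiply. This is what makes
    all the power series in [f] converge. *)
Lemma arith_expr_eq0 f k n : f 1%N = 0 -> (n < 2 ^ k)%N -> (f ^+ k) n = 0.
Proof.
move=> f1; elim: k n => [|k IHk] n lt_n.
  by case: n lt_n => // _; rewrite arith_at0.
have [->|n0] := posnP n; first by rewrite arith_at0.
rewrite exprS arith_mulE big1_seq // => d; rewrite -dvdn_divisors // => /andP[_ dn].
have [->|d1] := eqVneq d 1%N; first by rewrite f1 mul0r.
have d_gt1 : (1 < d)%N by rewrite ltn_neqAle eq_sym d1 (dvdn_gt0 n0).
rewrite IHk ?mulr0 // ltn_divLR ?(dvdn_gt0 n0) // (leq_trans lt_n) //.
by rewrite expnSr leq_pmul2l ?expn_gt0.
Qed.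

(** If [m] and [k] are the orders of [f] and [g], the only term of
    [(f * g) (m * k)] that survives is [f m * g k]. *)
Lemma arith_mulf_eq0 f g : f * g = 0 -> (f == 0) || (g == 0).
Proof.
move=> fg0; case: (eqVneq f 0) => //= f0; apply/negPn/negP => g0.
have ex h : h != 0 -> exists n, h n != 0.
  move=> h0; apply: contrapT => H; case/eqP: h0; apply: arithP => n.
  by apply/eqP; apply: contra_notT H => hn; exists n.
have [m fm m_min] := ex_minnP (ex f f0).
have [k gk k_min] := ex_minnP (ex g g0).
have pos h n : h n != 0 -> (0 < n)%N.
  by case: n => //; rewrite arith_at0 eqxx.
have m0 := pos _ _ fm; have k0 := pos _ _ gk.
have := congr1 (fun h : A => h (m * k)%N) fg0.
rewrite arith_mulE (bigD1_seq m) ?divisors_uniq //=; last first.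
  by rewrite -dvdn_divisors ?muln_gt0 ?m0 // dvdn_mulr.
rewrite mulKn // big1_seq ?addr0; last first.
  move=> d; rewrite -dvdn_divisors ?muln_gt0 ?m0 // => /andP[dm d_mk].
  have d0 : (0 < d)%N by rewrite (dvdn_gt0 _ d_mk) ?muln_gt0 ?m0.
  case: (ltngtP d m) => [lt_dm|lt_md|e]; last by rewrite e eqxx in dm.
    have [->|/m_min] := eqVneq (f d) 0; first by rewrite mul0r.
    by rewrite leqNgt lt_dm.
  have [->|/k_min] := eqVneq (g (m * k %/ d)%N) 0; first by rewrite mulr0.
  by rewrite leqNgt ltn_divLR // mulnC ltn_pmul2l // lt_md.
by move=> /eqP; rewrite mulf_eq0 (negPf fm) (negPf gk).
Qed.

Definition arith_unit : pred A := [pred f | `[< exists g, g * f = 1 >]].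

Definition arith_inv f : A :=
  if pselect (exists g, g * f = 1) is left e then sval (cid e) else f.

Fact arith_mulVr : {in arith_unit, left_inverse 1 arith_inv *%R}.
Proof.
move=> f /asboolP e; rewrite /arith_inv; case: pselect => // e'.
by case: (cid e').
Qed.

Fact arith_unitP f g : g * f = 1 -> f \in arith_unit.
Proof. by move=> gf; apply/asboolP; exists g. Qed.

Fact arith_inv_out : {in [predC arith_unit], arith_inv =1 id}.
Proof.
move=> f nf; rewrite /arith_inv; case: pselect => // e.
by case/negP: nf; apply/asboolP.
Qed.

HB.instance Definition _ := GRing.ComNzRing_hasMulInverse.Build A
  arith_mulVr arith_unitP arith_inv_out.
HB.instance Definition _ := GRing.ComUnitRing_isIntegral.Build A arith_mulf_eq0.

End ArithCoefficients.

(** * Convergence of sequences of arithmetic functions *)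
Section ArithConvergence.
Variable R : realType.
Local Notation A := (arith R).
Implicit Types f g h l : A.

Lemma arith_norm_lt N h : (0 < N)%N ->
  (arith_norm h < N%:R^-1) <-> (forall n, (n <= N)%N -> h n = 0).
Proof.
move=> N0; rewrite /arith_norm; case: pselect => [nz|z]; last first.
  rewrite invr_gt0 ltr0n N0; split=> // _ n _; apply/eqP.
  by apply: contra_notT z => hn; exists n.
case: ex_minnP => m hm m_min.
have m0 : (0 < m)%N by move: hm; case: (m) => //; rewrite arith_at0 eqxx.
rewrite ltf_pV2 ?posrE ?ltr0n // ltr_nat; split=> [lt_Nm n le_nN|h0].
  by apply/eqP; apply: contraTT lt_Nm => /m_min le_mn; rewrite -leqNgt (leq_trans le_mn).
by rewrite ltnNge; apply: contra hm => /h0->.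
Qed.

(** Convergence for the norm is eventual stationarity of every coefficient:
    being at distance less than [1/N] from [l] means having the coefficients of
    [l] up to [N]. *)
Lemma arith_cvgP (u : nat -> A) l :
  u @ \oo --> l <-> forall n, \forall k \near \oo, u k n = l n.
Proof.
split=> [/cvg_ballP ul n|ul].
  have [->|n0] := posnP n; first by near=> k; rewrite !arith_at0.
  have n1_gt0 : 0 < n%:R^-1 :> R by rewrite invr_gt0 ltr0n.
  have := ul _ n1_gt0; apply: filterS => k.
  rewrite ballEmdist /= => /(arith_norm_lt _ n0)/(_ n (leqnn n))/eqP.
  by rewrite /= subr_eq0 eq_sym => /eqP.
apply/cvg_ballP => e e0; pose N := (Num.truncn e^-1).+1.
have N0 : (0 < N)%N by [].
have lt_N : N%:R^-1 < e.
  by rewrite invf_plt ?posrE ?ltr0n // truncnS_gt.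
have : \forall k \near \oo, forall n : 'I_N.+1, u k n = l n.
  by apply: filter_forall => n; apply: ul.
apply: filterS => k ukl; rewrite ballEmdist /=.
apply: lt_trans lt_N; apply/arith_norm_lt => // n le_nN /=.
by rewrite (ukl (Ordinal (le_nN : n < N.+1)%N)) subrr.
Unshelve. all: by end_near.
Qed.

Lemma arith_cvg_unique (u : nat -> A) l l' : u @ \oo --> l -> u @ \oo --> l' -> l = l'.
Proof. by apply: cvg_unique; apply: metric_hausdorff. Qed.

Lemma arith_cvgM (u v : nat -> A) f g :
  u @ \oo --> f -> v @ \oo --> g -> (fun k => u k * v k) @ \oo --> f * g.
Proof.
move=> /arith_cvgP uf /arith_cvgP vg; apply/arith_cvgP => n.
have : \forall k \near \oo, forall d : 'I_n.+1, u k d = f d /\ v k d = g d.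
  by apply: filter_forall => d; apply: filterI; [apply: uf | apply: vg].
apply: filterS => k uv; have [->|n0] := posnP n; first by rewrite !arith_at0.
rewrite !arith_mulE; apply: eq_big_seq => d; rewrite -dvdn_divisors // => dn.
have lt_dn : (d < n.+1)%N by rewrite ltnS dvdn_leq.
have lt_nd : (n %/ d < n.+1)%N by rewrite ltnS leq_div.
by rewrite (uv (Ordinal lt_dn)).1 (uv (Ordinal lt_nd)).2.
Qed.

Lemma arith_cvg_series (c : nat -> R[i]) f : f 1%N = 0 ->
  cvgn (series (fun k => c k *: f ^+ k)).
Proof.
move=> f1; pose u := series (fun k => c k *: f ^+ k).
have l0 : u 0%N.+1 0%N == 0 by rewrite arith_at0.
suff : u @ \oo --> (@Arith R (fun n => u n.+1 n) l0 : A) by apply: cvgP.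
apply/arith_cvgP => n; near=> k; change (u k n = u n.+1 n).
rewrite /u !seriesEnat /= !arith_sumE.
rewrite (@big_cat_nat _ _ _ n.+1) //=; last by near: k; apply: nbhs_infty_gt.
rewrite -[RHS]addr0; congr (_ + _); rewrite big_nat_cond big1 // => j.
rewrite !andbT => /andP[lt_nj _].
by rewrite arith_expr_eq0 ?mulr0 // (leq_trans lt_nj) // ltnW // ltn_expl.
Unshelve. all: by end_near.
Qed.
End ArithConvergence.

(** * Derivations and the exponential *)
Section ExpDerivation.
Variable R : realType.
Local Notation A := (arith R).
Implicit Types f g h l : A.

Lemma Exp_series_cvg f : f 1%N = 0 ->
  series (fun k => (k`!%:R : R[i])^-1 *: f ^+ k) @ \oo --> Exp_series f.
Proof. exact: (@arith_cvg_series R (fun k => (k`!%:R)^-1)). Qed.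

Lemma derivation_is_derivation (D : A -> A) : derivation D -> is_derivation D.
Proof.
case=> linD DM; split=> // f g.
by rewrite addrC -scaleN1r linD scaleN1r addrC.
Qed.

Lemma derivation_scale (D : A -> A) a f : derivation D -> D (a *: f) = a *: D f.
Proof.
move=> hD; have := hD.1 a f 0.
by rewrite (der0 (derivation_is_derivation hD)) !addr0.
Qed.

Definition seq_continuous (D : A -> A) : Prop :=
  forall (u : nat -> A) l, u @ \oo --> l -> (fun k => D (u k)) @ \oo --> D l.

(** The derivative of a partial sum is the previous partial sum times [D f];
    pass to the limit on both sides. *)
Lemma der_Exp_series (D : A -> A) f : derivation D -> seq_continuous D ->
  f 1%N = 0 -> D (Exp_series f) = Exp_series f * D f.
Proof.
move=> hD Dcont f1; have hD' := derivation_is_derivation hD.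
pose u := series (fun k => (k`!%:R : R[i])^-1 *: f ^+ k).
have uE : u @ \oo --> Exp_series f := Exp_series_cvg f1.
have DuS k : D (u k.+1) = u k * D f.
  rewrite /u !seriesEnat /= big_nat_recl // (derD hD') expr0.
  rewrite derivation_scale // (der1 hD') scaler0 add0r (der_sum hD') mulr_suml.
  apply: eq_bigr => i _; rewrite derivation_scale // (derX hD') -scalerAl.
  rewrite -scalerMnr scalerMnl -mulr_natr factS natrM invfM mulrC mulrA.
  by rewrite mulfV ?mul1r // pnatr_eq0.
have DuE := Dcont _ _ uE.
apply: (arith_cvg_unique (u := fun k => u k * D f)).
  have := DuE; rewrite -(cvg_shiftS (fun k => D (u k))) /=.
  by under eq_fun do rewrite DuS.
by apply: arith_cvgM => //; apply: cvg_cst.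
Qed.

Lemma der_Exp (D : A -> A) f : derivation D -> seq_continuous D ->
  D (Exp f) = Exp f * D f.
Proof.
move=> hD Dcont; have hD' := derivation_is_derivation hD.
have DC a : D a%:A = 0 by rewrite derivation_scale // (der1 hD') scaler0.
rewrite /Exp (derM hD') DC mul0r add0r der_Exp_series //; last first.
  by rewrite /= mulr1 subrr.
by rewrite (derB hD') DC subr0 mulrA.
Qed.

Lemma Exp_at1 f : Exp f 1%N = expC (f 1%N).
Proof.
rewrite /Exp arith_mul_at1; set g := f - _.
have g1 : g 1%N = 0 by rewrite /g /= mulr1 subrr.
suff -> : Exp_series g 1%N = 1 by rewrite /= !mulr1.
have /arith_cvgP/(_ 1%N) := Exp_series_cvg g1.
have : \forall k \near \oo, (0 < k)%N by apply: nbhs_infty_gt.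
move=> gt0 E.
have [k [k0 <-]] := filter_ex (filterI gt0 E).
rewrite seriesEnat /= arith_sumE -(prednK k0) big_nat_recl //.
rewrite expr0 arith_scalerE arith_oneE eqxx fact0 invr1 mulr1.
rewrite big1 ?addr0 // => i _.
by rewrite arith_scalerE arith_expr_eq0 ?mulr0 // -[1%N](expn0 2) ltn_exp2l.
Qed.

Lemma expC_neq0 (z : R[i]) : expC z != 0.
Proof.
case: z => x y /=; rewrite eq_complex /= !mulf_eq0 !(gt_eqF (expR_gt0 x)) /=.
apply/negP => /andP[/eqP c0 /eqP s0]; have := cos2Dsin2 y.
by rewrite c0 s0 !expr0n addr0 => /eqP; rewrite eq_sym oner_eq0.
Qed.

Lemma Exp_neq0 f : Exp f != 0.
Proof.
apply/eqP => /(congr1 (fun h : A => h 1%N)); rewrite Exp_at1 => /eqP.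
by rewrite (negPf (expC_neq0 _)).
Qed.

Lemma continuous_seq_continuous (D : A -> A) : continuous D -> seq_continuous D.
Proof. by move=> Dcont u l ul; apply: continuous_cvg => //; apply: Dcont. Qed.
End ExpDerivation.

(** * Surjectivity of the exponential and iterated logarithms *)
Section Logarithm.
Variable R : realType.
Local Notation A := (arith R).
Implicit Types f g h : A.

(** Geometric series in [e = 1 - h / h(1)], whose powers tend to [0]. *)
Lemma arith_inv_exists h : h 1%N != 0 -> exists w, h * w = 1.
Proof.
move=> h1; pose e : A := 1 - (h 1%N)^-1 *: h.
have e1 : e 1%N = 0 by rewrite /e /= mulVf ?subrr.
pose u := series (fun k => (1 : R[i]) *: e ^+ k).
have ucvg := @arith_cvg_series R (fun=> 1) e e1.
have us := ucvg : u @ \oo --> lim (u @ \oo); set s := lim _ in us.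
have tel : (fun k => (1 - e) * u k) @ \oo --> (1 : A).
  have uE k : (1 - e) * u k = 1 - e ^+ k.
    rewrite /u seriesEord /= -opprB mulNr -[RHS]opprB subrX1.
    by congr (- (_ * _)); apply: eq_bigr => i _; rewrite scale1r.
  apply/arith_cvgP => n; near=> k; rewrite uE.
  have le_nk : (n <= k)%N by near: k; apply: nbhs_infty_ge.
  have lt_nk : (n < 2 ^ k)%N by exact: leq_ltn_trans le_nk (ltn_expl k (ltnSn 1)).
  by rewrite -[RHS]subr0 -[in RHS](arith_expr_eq0 e1 lt_nk).
exists ((h 1%N)^-1 *: s).
have <- : (1 - e) * s = 1.
  by apply: (arith_cvg_unique (arith_cvgM (cvg_cst _) us)).
by rewrite /e opprB addrC subrK -scalerAr scalerAl.
Unshelve. all: by end_near.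
Qed.

Fact log_der_subproof f : (ln (0%:R : R))%:C%C * f 0%N == 0.
Proof. by rewrite arith_at0 mulr0. Qed.
(** Pointwise multiplication by [ln n] is a continuous derivation whose kernel
    consists of the constants, because [ln] turns products into sums and
    vanishes at no [n > 1]. It serves as a logarithmic differentiation: finding
    [Log h] comes down to a division by [ln n]. *)
Definition log_der f : A := Arith (arith_fun := fun n => (ln (n%:R : R))%:C%C * f n)
  (log_der_subproof f).

Lemma log_derE f n : log_der f n = (ln (n%:R : R))%:C%C * f n.
Proof. by []. Qed.

Lemma log_der_derivation : derivation log_der.
Proof.
split=> [a f g|f g]; apply: arithP => n; first by rewrite /= mulrDr mulrCA.
have [->|n0] := posnP n; first by rewrite !arith_at0.
rewrite /= /conv mulr_sumr -big_split /=; apply: eq_big_seq => d.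
rewrite -dvdn_divisors // => dn.
have d0 := dvdn_gt0 n0 dn.
have nd0 : (0 < n %/ d)%N by rewrite divn_gt0 // dvdn_leq.
rewrite -{1}(divnK dn) natrM lnM ?posrE ?ltr0n // rmorphD /=.
by ring.
Qed.

Lemma log_der_continuous : seq_continuous log_der.
Proof.
move=> u l /arith_cvgP ul; apply/arith_cvgP => n.
by apply: filterS (ul n) => k /= ->.
Qed.

Lemma ln_natr_neq0 n : (1 < n)%N -> (ln (n%:R : R))%:C%C != 0.
Proof.
by move=> n1; rewrite eq_complex /= eqxx andbT gt_eqF // ln_gt0 // ltr1n.
Qed.

Lemma log_der_eq0 f : log_der f = 0 -> f 1%N = 1 -> f = 1.
Proof.
move=> Lf f1; apply: arithP => -[|[|n]]; rewrite ?arith_at0 ?f1 //.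
have := congr1 (fun h : A => h n.+2) Lf => /= /eqP.
by rewrite mulf_eq0 (negPf (ln_natr_neq0 _)) //= => /eqP.
Qed.

(** If [w] is the inverse of [h], solve [L g = w * L h] coefficientwise, where
    [L] is [log_der], with [g 1 = ln (h 1)]. Then [L (Exp g * w) = 0], so
    [Exp g * w] is the constant [1]. *)
Lemma Exp_surj h : A_pos h -> exists g, A_real g /\ Exp g = h.
Proof.
rewrite /A_pos /= => h1_gt0.
have [w hw] := arith_inv_exists (lt0r_neq0 h1_gt0).
have [a a_gt0 h1] : exists2 a : R, 0 < a & h 1%N = a%:C%C.
  case: (h 1%N) h1_gt0 => a b; rewrite ltcE /= => /andP[/eqP-> a0].
  by exists a.
pose q := w * log_der h.
have q1 : q 1%N = 0 by rewrite /q arith_mul_at1 /= ln1 mul0r mulr0.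
pose gf n := if n == 1%N then (ln a)%:C%C else (ln (n%:R : R))%:C%C^-1 * q n.
have gf0 : gf 0%N == 0 by rewrite /gf (arith_at0 q) mulr0.
pose g : A := Arith gf0.
have Lg : log_der g = q.
  apply: arithP => -[|[|n]]; first by rewrite !arith_at0.
    by rewrite q1 log_derE ln1 mul0r.
  have gE : g n.+2 = (ln (n.+2%:R : R))%:C%C^-1 * q n.+2 by [].
  by rewrite log_derE gE mulVKf // ln_natr_neq0.
exists g; split.
  by rewrite /A_real /= /gf /= complex_real.
have hL := derivation_is_derivation log_der_derivation.
have Ew1 : Exp g * w = 1.
  apply: log_der_eq0.
    rewrite (derM hL) der_Exp ?Lg; last 2 first.
    - exact: log_der_derivation.
    - exact: log_der_continuous.
    have Lw : log_der w = - (w * q).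
      have := congr1 (@log_der) hw; rewrite (derM hL) (der1 hL) => /eqP.
      rewrite addrC addr_eq0 => /eqP/(congr1 (fun f => w * f)).
      by rewrite mulrA [w * h]mulrC hw mul1r mulrN /q => ->; ring.
    by rewrite Lw; ring.
  have hw1 := congr1 (fun f : A => f 1%N) hw.
  rewrite arith_mul_at1 Exp_at1 -[RHS]hw1 arith_mul_at1; congr (_ * _).
  by rewrite h1 /= lnK ?posrE // cos0 sin0 mulr1 mulr0.
by rewrite -[RHS]mul1r -Ew1 -mulrA [w * h]mulrC hw mulr1.
Qed.

Lemma LogK h : A_pos h -> Exp (Log h) = h.
Proof. by move=> /Exp_surj h_ex; case: (xgetPex 0 h_ex). Qed.

Lemma Log_depth_defined (W : set A) f : W f -> Log_defined (Log_depth W) f.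
Proof. by move=> Wf; rewrite /Log_depth; case: xgetP => [k _ [] /(_ f Wf)|_ j]. Qed.

Lemma iter_LogK k f j : Log_defined k f -> (j <= k)%N ->
  iter (k - j) Exp (iter k Log f) = iter j Log f.
Proof.
move=> fk le_jk; have le_k : (k - j + j <= k)%N by rewrite subnK.
rewrite -{2}(subnK le_jk); elim: (k - j)%N le_k => // l IHl lt_lk.
by rewrite iterSr addSn iterS LogK ?IHl ?(ltnW lt_lk) //; apply: fk.
Qed.

(** Seen from the deepest common logarithms, only nonnegative iterates of [Exp]
    occur. *)
Lemma Exp_star_iter (W : set A) h : Exp_star W h ->
  exists f m, W f /\ h = iter m Exp (iter (Log_depth W) Log f).
Proof.
move=> [f [m [Wf le_m ->]]]; have fk := Log_depth_defined Wf; exists f.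
case: m le_m => m le_m; last first.
  exists (Log_depth W - m.+1)%N; split=> //; rewrite iter_LogK //.
  by move: le_m; rewrite NegzE lerN2 lez_nat.
exists (m + Log_depth W)%N; split=> //; rewrite iterD.
by have := iter_LogK fk (leq0n _); rewrite subn0 => ->.
Qed.

Lemma der_iter_Exp (D : A -> A) g m : derivation D -> seq_continuous D ->
  D (iter m Exp g) = (\prod_(l < m) iter l.+1 Exp g) * D g.
Proof.
move=> hD Dc; elim: m => [|m IHm]; first by rewrite big_ord0 mul1r.
by rewrite big_ord_recr /= der_Exp // IHm mulrA [_ * \prod_(_ < m) _]mulrC.
Qed.
End Logarithm.

(** * Proof of the theorem *)

Theorem theorem3p5 (R : realType) (n : nat) (f : 'I_n -> arith R)
    (D : 'I_n -> arith R -> arith R) :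
  (0 < n)%N ->
  (forall j, derivation (D j) /\ continuous (D j)) ->
  \det (\matrix_(i < n, j < n) D j (f i)) != 0 ->
  alg_independent (ker_der (range D)) (Exp_star (range f)).
Proof.
move=> _ DP det_f k x x_inj xS p Cp p0.
have hD j : derivation (D j) := (DP j).1.
have hD' j := derivation_is_derivation (hD j).
have Dc j : seq_continuous (D j) := continuous_seq_continuous (DP j).2.
set K := Log_depth (range f).
pose g i : arith R := iter K Log (f i).
have fE i : f i = iter K Exp (g i).
  rewrite -[RHS]/(iter K Exp (iter K Log (f i))) -{1}[K]subn0 iter_LogK //.
  by apply: Log_depth_defined; exists i.
pose J := \matrix_(i < n, j < n) D j (g i).
have det_g : \det J != 0.
  apply: contraNneq det_f => detJ0.
  pose P := \row_i \prod_(l < K) iter l.+1 Exp (g i).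
  suff -> : \matrix_(i < n, j < n) D j (f i) = diag_mx P *m J.
    by rewrite det_mulmx detJ0 mulr0.
  by apply/matrixP => i j; rewrite mul_diag_mx !mxE fE der_iter_Exp.
(* By Cramer's rule, E j (g i) is det J if i = j and 0 otherwise. *)
pose E j h := \sum_l \adj J l j * D l h.
have hE j : is_derivation (E j) by apply: is_derivation_sum.
pose y i m := iter m Exp (g i).
have /choice[s sP] : forall i : 'I_k, exists im, x i = y im.1 im.2.
  by move=> i; have [_ [m [[j _ <-] ->]]] := Exp_star_iter (xS i); exists (j, m).
have s_inj : injective s.
  by move=> i i' ss; apply: x_inj; rewrite !sP ss.
pose C := der_ker hD'.
have CP c : ker_der (range D) c -> c \in C.
  by move=> c0; apply/der_kerP => j; apply: c0; exists j.
apply: (@exp_towers_alg_indep (arith R) n E y (\det J) C _ hE det_g _ _ _ _ k s s_inj).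
- exact: arith_natr_neq0.
- move=> i j; rewrite /E /y /=.
  have := congr1 (fun M : 'M[arith R]_n => M i j) (mul_mx_adj J).
  rewrite !mxE => <-; apply: eq_bigr => l _; by rewrite !mxE mulrC.
- by move=> i m; apply: Exp_neq0.
- move=> i j m; rewrite /E mulr_sumr; apply: eq_bigr => l _.
  by rewrite [y i m.+1]/= der_Exp // mulrCA.
- by move=> j c /der_kerP Dc0; rewrite /E big1 // => l _; rewrite Dc0 mulr0.
- by move=> m; apply/CP/Cp.
- by rewrite -p0; apply: meval_eq => i; rewrite sP.
Qed.
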